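(* Derivability in $\mathsf{G3SDM}$ is decidable: there is an algorithm which, given an SDM-sequent $\Gamma\Rightarrow\alpha$, decides whether $\mathsf{G3SDM}\vdash\Gamma\Rightarrow\alpha$.
   Context: Let $\Xi=\{p_n\mid n\in\omega\}$ be a denumerable set of propositional variables. Terms are generated by $\varphi::=p\mid\bot\mid{\sim}\varphi\mid(\varphi\wedge\varphi)\mid(\varphi\vee\varphi)$ with $p\in\Xi$. A basic SDM-structure is an expression $\varphi$ or $*\varphi$ where $\varphi$ is a term ($*$ is a formal symbol). An SDM-structure is a finite (possibly empty) multiset of basic SDM-structures; the comma denotes multiset union. An SDM-sequent is $\Gamma\Rightarrow\alpha$ with $\Gamma$ an SDM-structure and $\alpha$ a basic SDM-structure. The calculus $\mathsf{G3SDM}$ (with $p\in\Xi$, $\varphi,\psi,\varphi_1,\varphi_2$ arbitrary terms, $\Gamma$ an arbitrary SDM-structure, $\beta$ an arbitrary basic SDM-structure) has axioms: $p,\Gamma\Rightarrow p$; $\bot,\Gamma\Rightarrow\beta$; $\Gamma\Rightarrow *\bot$; $*{\sim}\bot,\Gamma\Rightarrow\beta$. Rules: from $\varphi,\psi,\Gamma\Rightarrow\beta$ infer $\varphi\wedge\psi,\Gamma\Rightarrow\beta$; from $\Gamma\Rightarrow\varphi$ and $\Gamma\Rightarrow\psi$ infer $\Gamma\Rightarrow\varphi\wedge\psi$; from $\varphi,\Gamma\Rightarrow\beta$ and $\psi,\Gamma\Rightarrow\beta$ infer $\varphi\vee\psi,\Gamma\Rightarrow\beta$; from $\Gamma\Rightarrow\varphi_i$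 ($i=1$ or $2$) infer $\Gamma\Rightarrow\varphi_1\vee\varphi_2$; from $*\varphi,*\psi,\Gamma\Rightarrow\beta$ infer $*(\varphi\vee\psi),\Gamma\Rightarrow\beta$; from $\Gamma\Rightarrow *\varphi$ and $\Gamma\Rightarrow *\psi$ infer $\Gamma\Rightarrow *(\varphi\vee\psi)$; from $*{\sim}\varphi,*{\sim}\psi,\Gamma\Rightarrow\beta$ infer $*{\sim}(\varphi\wedge\psi),\Gamma\Rightarrow\beta$; from $\Gamma\Rightarrow *{\sim}\varphi$ and $\Gamma\Rightarrow *{\sim}\psi$ infer $\Gamma\Rightarrow *{\sim}(\varphi\wedge\psi)$; from $*\varphi,\Gamma\Rightarrow\beta$ infer $*{\sim}{\sim}\varphi,\Gamma\Rightarrow\beta$; from $\Gamma\Rightarrow *\varphi$ infer $\Gamma\Rightarrow *{\sim}{\sim}\varphi$; from $*\varphi,\Gamma\Rightarrow\beta$ infer ${\sim}\varphi,\Gamma\Rightarrow\beta$; from $\Gamma\Rightarrow *\varphi$ infer $\Gamma\Rightarrow{\sim}\varphi$; and the structural rule $( * )$: from $\varphi\Rightarrow\psi$ infer $*\psi,\Gamma\Rightarrow *\varphi$. $\mathsf{G3SDM}\vdash\Gamma\Rightarrow\alpha$ means that $\Gamma\Rightarrow\alpha$ has a derivation from these axioms by these rules. *)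

(* Defs.v *)
From HB Require Import structures.
From mathcomp Require Import all_boot finmap multiset.

Set Implicit Arguments.
Unset Strict Implicit.
Unset Printing Implicit Defensive.

(** * Terms, structures and sequents *)

Inductive formula : Type :=
| Var of nat
| Bot
| Neg of formula
| And of formula & formula
| Or of formula & formula.

(* [Plain phi] is the basic structure phi, [Star phi] is *phi. *)
Inductive basic : Type :=
| Plain of formula
| Star of formula.

(* The library's multisets need a [choiceType], obtained here by embedding
   the syntax into generic trees. *)
Fixpoint formula_tree (phi : formula) : GenTree.tree nat :=
  match phi with
  | Var n => GenTree.Leaf n
  | Bot => GenTree.Node 0 [::]
  | Neg a => GenTree.Node 1 [:: formula_tree a]
  | And a b => GenTree.Node 2 [:: formula_tree a; formula_tree b]
  | Or a b => GenTree.Node 3 [:: formula_tree a; formula_tree b]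
  end.

Fixpoint tree_formula (t : GenTree.tree nat) : formula :=
  match t with
  | GenTree.Leaf n => Var n
  | GenTree.Node 1 [:: a] => Neg (tree_formula a)
  | GenTree.Node 2 [:: a; b] => And (tree_formula a) (tree_formula b)
  | GenTree.Node 3 [:: a; b] => Or (tree_formula a) (tree_formula b)
  | _ => Bot
  end.

Lemma formula_treeK : cancel formula_tree tree_formula.
Proof. by elim=> //= [a -> | a -> b -> | a -> b ->]. Qed.

HB.instance Definition _ := Countable.copy formula (can_type formula_treeK).

Definition basic_sum (x : basic) : formula + formula :=
  match x with Plain a => inl a | Star a => inr a end.

Definition sum_basic (s : formula + formula) : basic :=
  match s with inl a => Plain a | inr a => Star a end.

Lemma basic_sumK : cancel basic_sum sum_basic.
Proof. by case. Qed.

HB.instance Definition _ := Countable.copy basic (can_type basic_sumK).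

Local Open Scope mset_scope.

Notation structure := {mset basic}.

Definition sequent : Type := (structure * basic)%type.

(** * The calculus *)

Reserved Notation "'G3SDM' |- G => a"
  (at level 70, G at level 65, a at level 65).

Inductive G3SDM_derivable : sequent -> Prop :=
| Ax p G : G3SDM |- Plain (Var p) +` G => Plain (Var p)
| BotL G b : G3SDM |- Plain Bot +` G => b
| StarBotR G : G3SDM |- G => Star Bot
| StarNegBotL G b : G3SDM |- Star (Neg Bot) +` G => b
| AndL phi psi G b :
    G3SDM |- Plain phi +` (Plain psi +` G) => b ->
    G3SDM |- Plain (And phi psi) +` G => b
| AndR phi psi G :
    G3SDM |- G => Plain phi ->
    G3SDM |- G => Plain psi ->
    G3SDM |- G => Plain (And phi psi)
| OrL phi psi G b :
    G3SDM |- Plain phi +` G => b ->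
    G3SDM |- Plain psi +` G => b ->
    G3SDM |- Plain (Or phi psi) +` G => b
| OrR1 phi1 phi2 G :
    G3SDM |- G => Plain phi1 ->
    G3SDM |- G => Plain (Or phi1 phi2)
| OrR2 phi1 phi2 G :
    G3SDM |- G => Plain phi2 ->
    G3SDM |- G => Plain (Or phi1 phi2)
| StarOrL phi psi G b :
    G3SDM |- Star phi +` (Star psi +` G) => b ->
    G3SDM |- Star (Or phi psi) +` G => b
| StarOrR phi psi G :
    G3SDM |- G => Star phi ->
    G3SDM |- G => Star psi ->
    G3SDM |- G => Star (Or phi psi)
| StarNegAndL phi psi G b :
    G3SDM |- Star (Neg phi) +` (Star (Neg psi) +` G) => b ->
    G3SDM |- Star (Neg (And phi psi)) +` G => b
| StarNegAndR phi psi G :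
    G3SDM |- G => Star (Neg phi) ->
    G3SDM |- G => Star (Neg psi) ->
    G3SDM |- G => Star (Neg (And phi psi))
| StarNegNegL phi G b :
    G3SDM |- Star phi +` G => b ->
    G3SDM |- Star (Neg (Neg phi)) +` G => b
| StarNegNegR phi G :
    G3SDM |- G => Star phi ->
    G3SDM |- G => Star (Neg (Neg phi))
| NegL phi G b :
    G3SDM |- Star phi +` G => b ->
    G3SDM |- Plain (Neg phi) +` G => b
| NegR phi G :
    G3SDM |- G => Star phi ->
    G3SDM |- G => Plain (Neg phi)
| StarRule phi psi G :
    G3SDM |- [mset Plain phi] => Plain psi ->
    G3SDM |- Star psi +` G => Star phi
where "'G3SDM' |- G => a" := (G3SDM_derivable (G, a)).

(** * Algorithms

   An algorithm is a closed term of the weak call-by-value lambda-calculus,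
   a Turing-complete model of computation.  A function into [bool] (or a
   [sumbool]) would not express decidability: excluded middle together with
   choice yields one for every predicate. *)

(* De Bruijn indices. *)
Inductive tm : Type :=
| tvar of nat
| tapp of tm & tm
| tlam of tm.

Fixpoint closed_below (k : nat) (t : tm) : bool :=
  match t with
  | tvar n => n < k
  | tapp s u => closed_below k s && closed_below k u
  | tlam s => closed_below k.+1 s
  end.

Definition closed_tm (t : tm) : bool := closed_below 0 t.

(* [v] is not shifted under binders: evaluation of closed terms only ever
   substitutes closed terms. *)
Fixpoint subst (t : tm) (k : nat) (v : tm) : tm :=
  match t with
  | tvar n => if n == k then v else tvar n
  | tapp s u => tapp (subst s k v) (subst u k v)
  | tlam s => tlam (subst s k.+1 v)
  end.

Inductive eval : tm -> tm -> Prop :=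
| eval_lam s : eval (tlam s) (tlam s)
| eval_app s t s' v w :
    eval s (tlam s') -> eval t v -> eval (subst s' 0 v) w ->
    eval (tapp s t) w.

Lemma eval_det t v w : eval t v -> eval t w -> v = w.
Proof.
move=> tv; elim: tv w => [s w | s u s' v' w' _ IHs _ IHu _ IHb w tw].
  by move=> sw; inversion sw.
inversion tw as [|? ? s1 v1 ? es eu eb]; subst.
by case: (IHs _ es) => ?; subst; have ? := IHu _ eu; subst; apply: IHb.
Qed.

(* Scott encoding: the [i]-th of [n] constructors applied to [args] is
   [fun x_0 ... x_(n-1) => x_i args]. *)
Definition scott (n i : nat) (args : seq tm) : tm :=
  iter n tlam (foldl tapp (tvar (n - i.+1)) args).

Definition code_bool (b : bool) : tm := scott 2 (if b then 0 else 1) [::].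

Fixpoint code_nat (n : nat) : tm :=
  if n is m.+1 then scott 2 1 [:: code_nat m] else scott 2 0 [::].

Fixpoint code_formula (phi : formula) : tm :=
  match phi with
  | Var n => scott 5 0 [:: code_nat n]
  | Bot => scott 5 1 [::]
  | Neg a => scott 5 2 [:: code_formula a]
  | And a b => scott 5 3 [:: code_formula a; code_formula b]
  | Or a b => scott 5 4 [:: code_formula a; code_formula b]
  end.

Definition code_basic (x : basic) : tm :=
  match x with
  | Plain a => scott 2 0 [:: code_formula a]
  | Star a => scott 2 1 [:: code_formula a]
  end.

Fixpoint code_list (l : seq basic) : tm :=
  if l is x :: l' then scott 2 1 [:: code_basic x; code_list l']
  else scott 2 0 [::].

(* A multiset is presented to an algorithm by any list enumerating it, so a
   sequent has one code for each ordering of its left-hand side. *)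
Definition sequent_code (S : sequent) (t : tm) : Prop :=
  exists2 l : seq basic,
    seq_mset l = S.1 & t = scott 1 0 [:: code_list l; code_basic S.2].

Lemma sequent_code_total S : exists t, sequent_code S t.
Proof. by eexists; exists (enum_mset S.1); rewrite ?seq_mset_id. Qed.

Definition algorithmically_decidable
    (X : Type) (code : X -> tm -> Prop) (P : X -> Prop) : Prop :=
  exists2 u : tm, closed_tm u &
    forall (x : X) (t : tm), code x t ->
      (P x -> eval (tapp u t) (code_bool true)) /\
      (~ P x -> eval (tapp u t) (code_bool false)).

(* Main.v *)
From mathcomp Require Import all_boot finmap multiset zify.
Require Import Defs.

Set Implicit Arguments.
Unset Strict Implicit.
Unset Printing Implicit Defensive.
Local Open Scope mset_scope.

(** Read from conclusion to premises, every rule replaces its sequent by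
    sequents of smaller weight, for a suitable weight of basic structures
    ([basic_weight]); the structural rule is no exception, since it strips both
    stars and deletes the context.  A sequent is the conclusion of only finitely
    many rule instances, each determined by the rule and the principal structure.  As a
    sequent is derivable iff some
    rule instance concluding it has derivable premises ([derivable_step]),
    exhaustive backward search terminates and decides derivability.

    It remains to carry out the search by a lambda-term.  The search is written
    once, as the term [prove_tm], in a small notation with named variables
    ([prog]); its behaviour is established by rules in the manner of Hoare logic
    for a judgment [returns env p R]: in the environment [env] of values the
    program [p] evaluates to some value satisfying [R].  In its instance
    [decides env p Q] the value is a boolean equivalent to the proposition [Q].
    Conjunction and disjunction of booleans then follow the shape of
    [derivable_step], and the recursive calls of the search are covered by
    induction on the weight ([decides_prove]), which shows at the same time that
    the term terminates and that its answer is right. *)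

(** * Evaluation in an environment *)

Definition is_value (t : tm) : bool :=
  (if t is tlam _ then true else false) && closed_tm t.

Lemma closed_belowW k k' t : k <= k' -> closed_below k t -> closed_below k' t.
Proof.
elim: t k k' => [n|s IHs u IHu|s IHs] k k' lek /=.
- by move=> /leq_trans; apply.
- by case/andP=> /(IHs _ _ lek) -> /(IHu _ _ lek).
- exact: IHs.
Qed.

Lemma subst_closed k t v : closed_below k t -> subst t k v = t.
Proof.
elim: t k => [n|s IHs u IHu|s IHs] k /=.
- by move=> ltnk; rewrite ltn_eqF.
- by case/andP=> /IHs -> /IHu ->.
- by move/IHs->.
Qed.

Lemma closed_below_subst k t v :
  closed_tm v -> closed_below k.+1 t -> closed_below k (subst t k v).
Proof.
move=> cv; elim: t k => [n|s IHs u IHu|s IHs] k /=.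
- case: eqP => [_ _|/eqP nk ltnk]; first exact: closed_belowW cv.
  by rewrite /= ltn_neqAle nk.
- by case/andP=> /IHs -> /IHu.
- exact: IHs.
Qed.

Lemma eval_is_value t v : closed_tm t -> eval t v -> is_value v.
Proof.
move=> ct tv; elim: tv ct => [//|s u s' v' w _ IHs _ IHu _ IHb] /andP[cs cu].
have /andP[_ cs'] := IHs cs; have /andP[_ cv'] := IHu cu.
exact/IHb/closed_below_subst.
Qed.

Lemma eval_value v : is_value v -> eval v v.
Proof. by case: v => // s _; apply: eval_lam. Qed.

(** Simultaneous substitution of closed values for the variables from [k] on.
    The environment grows at its end, so the innermost variable is its last
    entry.  Variables outside the environment become an arbitrary closed term,
    so that the result is closed whatever [t] is. *)
Fixpoint close (k : nat) (env : seq tm) (t : tm) : tm :=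
  match t with
  | tvar n => if n < k then tvar n else nth (tlam (tvar 0)) (rev env) (n - k)
  | tapp s u => tapp (close k env s) (close k env u)
  | tlam s => tlam (close k.+1 env s)
  end.

Lemma close_closed k env t : closed_below k t -> close k env t = t.
Proof.
elim: t k => [n|s IHs u IHu|s IHs] k /=.
- by move=> ->.
- by case/andP=> /IHs -> /IHu ->.
- by move/IHs->.
Qed.

Lemma closed_close k env t :
  all is_value env -> closed_below k (close k env t).
Proof.
move=> venv; elim: t k => [n|s IHs u IHu|s IHs] k //=; last by rewrite IHs IHu.
case: ltnP => //= _; apply: (@closed_belowW 0) => //.
have [lt_n|le_n] := ltnP (n - k) (size (rev env)); last by rewrite nth_default.
have venv' : all is_value (rev env) by rewrite all_rev.
by have /andP[] := all_nthP (tlam (tvar 0)) venv' _ lt_n.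
Qed.

(** The substitution made by a beta-step extends the environment. *)
Lemma subst_close k env s v :
  all is_value env -> subst (close k.+1 env s) k v = close k (rcons env v) s.
Proof.
move=> venv; elim: s k => [n|s IHs u IHu|s IHs] k /=; last 2 first.
- by rewrite IHs IHu.
- by rewrite IHs.
rewrite ltnS rev_rcons; case: (ltngtP n k) => [ltnk|ltkn|->] /=.
- by rewrite ltn_eqF.
- rewrite subst_closed; first by rewrite -(subnSK ltkn).
  have -> : nth (tlam (tvar 0)) (rev env) (n - k.+1) =
      close 0 env (tvar (n - k.+1)) by rewrite /= subn0.
  exact/(closed_belowW (leq0n k))/closed_close.
- by rewrite eqxx subnn.
Qed.

Lemma eval_idem t v : eval t v -> eval v v.
Proof. by elim=> // s; apply: eval_lam. Qed.

Lemma eval_beta env f s t v w :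
  all is_value env -> eval f (close 0 env (tlam s)) -> eval t v ->
  eval (close 0 (rcons env v) s) w -> eval (tapp f t) w.
Proof. by move=> venv fv tv; rewrite -subst_close //; apply: eval_app fv tv. Qed.

(** The hypothesis on [f] is not that [f] evaluates to the iterated abstraction:
    in the base case [body] itself need not be a value, and an application of no
    arguments has to evaluate as [body] does. *)
Lemma eval_iter_lam env body f bs :
  all is_value env -> all closed_tm bs ->
  (forall w, eval (close 0 env (iter (size bs) tlam body)) w -> eval f w) ->
  (forall i, i < size bs -> exists v, eval (nth (tvar 0) bs i) v) ->
  exists vs, [/\ size vs = size bs, all is_value vs,
    forall i, i < size bs -> eval (nth (tvar 0) bs i) (nth (tvar 0) vs i) &
    forall w, eval (close 0 (env ++ vs) body) w -> eval (foldl tapp f bs) w].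
Proof.
elim: bs env f => [|b bs IH] env f venv /=.
  by move=> _ fv _; exists [::]; split=> // w; rewrite cats0; apply: fv.
move=> /andP[cb cbs] fv hbs.
have [v bv] := hbs 0 isT; have vv := eval_is_value cb bv.
have venv' : all is_value (rcons env v) by rewrite all_rcons vv.
have [|vs [sz vvs ev app]] := IH _ (tapp f b) venv' cbs _ (fun i => hbs i.+1).
  by move=> w; apply: eval_beta venv (fv _ (eval_lam _)) bv.
exists (v :: vs); split=> [||[|i]|w]; rewrite /= ?sz ?vv //; first exact: ev.
by rewrite -cat_rcons; apply: app.
Qed.

Lemma eval_foldl_tapp f f' bs w :
  eval f f' -> eval (foldl tapp f bs) w <-> eval (foldl tapp f' bs) w.
Proof.
elim/last_ind: bs w => [|bs b IH] w ff'.
  split=> [fw|f'w]; first by rewrite -(eval_det ff' fw); apply: eval_idem ff'.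
  by rewrite (eval_det f'w (eval_idem ff')).
rewrite -cats1 !foldl_cat /=.
by split=> ev; inversion ev as [|? ? ? ? ? fs bv sw]; subst;
  apply: eval_app bv sw; apply/(IH _ ff').
Qed.

Lemma closed_foldl_tapp k f bs :
  closed_below k (foldl tapp f bs) = closed_below k f && all (closed_below k) bs.
Proof. by elim: bs f => [|b bs IH] f /=; rewrite ?andbT // IH /= andbA. Qed.

Lemma close_foldl_tapp k env f bs :
  close k env (foldl tapp f bs) =
    foldl tapp (close k env f) [seq close k env b | b <- bs].
Proof. by elim: bs f => //= b bs IH f; rewrite IH. Qed.

Lemma closed_iter_lam n k t :
  closed_below k (iter n tlam t) = closed_below (n + k) t.
Proof. by elim: n k => //= n IH k; rewrite IH addnS. Qed.

Lemma scott_is_value n i args :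
  i < n -> all is_value args -> is_value (scott n i args).
Proof.
case: n => // n ltin vargs; apply/andP; split=> //.
rewrite /closed_tm /scott closed_iter_lam closed_foldl_tapp /= addn0 subSS.
rewrite ltnS leq_subr /=; apply: sub_all vargs => t /andP[_].
exact: closed_belowW.
Qed.

(** Case analysis on a Scott-encoded value is application to one branch per
    constructor.  Evaluation is call-by-value, hence all branches are evaluated,
    although only the selected one matters for the result. *)
Lemma eval_scott t n i args bs w :
  i < n -> size bs = n -> all is_value args -> all closed_tm bs ->
  eval t (scott n i args) ->
  (forall j, j < n -> exists v, eval (nth (tvar 0) bs j) v) ->
  eval (foldl tapp (nth (tvar 0) bs i) args) w ->
  eval (foldl tapp t bs) w.
Proof.
move=> ltin szbs vargs cbs tv hbs ev; rewrite -{n}szbs in ltin tv hbs.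
have /andP[_ /close_closed csc] := scott_is_value ltin vargs.
have [|vs [szvs vvs bvs]] :=
    @eval_iter_lam [::] (foldl tapp (tvar (size bs - i.+1)) args) t bs
      isT cbs _ hbs.
  by move=> w'; rewrite csc => sw; rewrite -(eval_det (eval_idem tv) sw).
apply; rewrite close_foldl_tapp /= subn0 nth_rev; last lia.
rewrite szvs -subSn // subSS subKn; last exact: ltnW.
have -> : [seq close 0 vs a | a <- args] = args.
  elim: args vargs {ev tv csc} => //= a l IH /andP[/andP[_ ca] /IH->].
  by rewrite close_closed.
rewrite (set_nth_default (tvar 0)) ?szvs //.
exact/(eval_foldl_tapp args w (bvs i ltin)).
Qed.

(** * Programs with named variables *)

(** A program is a term depending on the number of abstractions around it.  A
    variable is identified by the depth at which it is bound, counted from the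
    outside, and is turned into an index where it occurs; [lam] can therefore
    bind a meta-level variable.  In an environment [env], the variable [var i]
    refers to entry [i] of [env]. *)
Definition prog : Type := nat -> tm.

Definition const (t : tm) : prog := fun=> t.
Definition var (i : nat) : prog := fun d => tvar (d - i.+1).
Definition app (p q : prog) : prog := fun d => tapp (p d) (q d).
Definition apps (p : prog) (qs : seq prog) : prog := foldl app p qs.

Lemma appsE p qs d : apps p qs d = foldl tapp (p d) [seq q d | q : prog <- qs].
Proof. by elim: qs p => //= q qs IH p; rewrite -IH. Qed.

Definition lam (f : prog -> prog) : prog := fun d => tlam (f (var d) d.+1).

Notation "p @ q" := (app p q) (at level 40, left associativity).

(** The premise on [env] is part of the judgment, so that the rules below do not
    have to carry it: each of them extends the environment by values only. *)
Definition returns (env : seq tm) (p : prog) (R : tm -> Prop) : Prop :=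
  all is_value env -> exists2 v, eval (close 0 env (p (size env))) v & R v.

Definition computes env p v := returns env p (fun w => w = v).
Definition halts env p := returns env p (fun=> True).
Definition decides env p (Q : Prop) :=
  returns env p (fun w => exists2 c, w = code_bool c & (Q <-> c)).

(** The program [p] returns the function [f] with its free variables fixed by
    [env'], which differs from [env] when [p] is a call of a closed function. *)
Definition closure env p env' f :=
  returns env p (fun w =>
    w = close 0 env' (lam f (size env')) /\ all is_value env').

Lemma returnsW env p (R R' : tm -> Prop) :
  (forall v, R v -> R' v) -> returns env p R -> returns env p R'.
Proof. by move=> sR h /h[v ev /sR]; exists v. Qed.

Lemma halts_returns env p R : returns env p R -> halts env p.
Proof. exact: returnsW. Qed.

Lemma decides_iff env p P Q : (P <-> Q) -> decides env p P -> decides env p Q.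
Proof.
move=> PQ; apply: returnsW => v [c -> cP]; exists c => //.
exact: iff_trans (iff_sym PQ) cP.
Qed.

Lemma computes_var env i : i < size env ->
  computes env (var i) (nth (tvar 0) env i).
Proof.
move=> lti venv; exists (nth (tvar 0) env i) => //=.
rewrite subn0 nth_rev; last lia.
rewrite -subSn // subSS subKn; last exact: ltnW.
rewrite (set_nth_default (tvar 0)) //; apply: eval_value.
exact: (all_nthP (tvar 0) venv _ lti).
Qed.

Lemma computes_const env v : is_value v -> computes env (const v) v.
Proof.
move=> vv _; exists v => //; rewrite close_closed; last by case/andP: vv.
exact: eval_value.
Qed.

Lemma closure_lam env f : closure env (lam f) env f.
Proof.
by move=> venv; exists (close 0 env (lam f (size env))) => //; apply: eval_lam.
Qed.

Lemma returns_app env env' p q f v R :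
  closure env p env' f -> computes env q v ->
  returns (rcons env' v) (f (var (size env'))) R -> returns env (p @ q) R.
Proof.
move=> cp cq cf venv; case: (cp venv) => w ep [Ew venv']; subst w.
case: (cq venv) => w eq Ew; subst w.
have vv : is_value v by apply: eval_is_value eq; apply: closed_close.
have [|w ew Rw] := cf; first by rewrite all_rcons vv.
by exists w => //; apply: eval_beta ep eq _ => //; rewrite -(size_rcons env' v).
Qed.

Lemma returns_apps env i t bs args R :
  i < size bs -> all is_value args ->
  computes env t (scott (size bs) i args) ->
  (forall j, j < size bs -> halts env (nth (const (tvar 0)) bs j)) ->
  returns env (apps (nth (const (tvar 0)) bs i) [seq const v | v <- args]) R ->
  returns env (apps t bs) R.
Proof.
move=> lti vargs ct hbs rb venv; case: (ct venv) => v et Ev; subst v.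
have [w ew Rw] := rb venv; exists w => //.
rewrite appsE close_foldl_tapp -map_comp in ew.
rewrite appsE close_foldl_tapp -map_comp.
have Eargs : [seq close 0 env v | v <- args] = args.
  elim: args vargs {ct rb et ew} => //= a l IH /andP[/andP[_ ca] /IH->].
  by rewrite close_closed.
have Ebs j : j < size bs ->
    nth (tvar 0) [seq close 0 env (b (size env)) | b : prog <- bs] j =
      close 0 env (nth (const (tvar 0)) bs j (size env)).
  by move=> ltj; rewrite (nth_map (const (tvar 0))).
apply: (eval_scott lti _ vargs _ et); rewrite ?size_map //.
- rewrite all_map; elim: bs {lti ct hbs rb et ew Ebs} => //= b bs ->.
  by rewrite andbT; apply: closed_close.
- by move=> j ltj; rewrite Ebs //; have [v] := hbs j ltj venv; exists v.
- rewrite Ebs //; move: ew.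
  by rewrite -map_comp -[X in _ -> eval (foldl _ _ X) _]Eargs.
Qed.

(** * Data *)

Lemma code_nat_is_value n : is_value (code_nat n).
Proof. by elim: n => // n IH; apply: scott_is_value; rewrite //= IH. Qed.

Lemma code_formula_is_value f : is_value (code_formula f).
Proof.
by elim: f => [n||a IHa|a IHa b IHb|a IHa b IHb]; apply: scott_is_value;
  rewrite //= ?code_nat_is_value ?IHa ?IHb.
Qed.

Lemma code_basic_is_value x : is_value (code_basic x).
Proof.
by case: x => f; apply: scott_is_value; rewrite //= code_formula_is_value.
Qed.

Lemma code_list_is_value l : is_value (code_list l).
Proof.
elim: l => [|x l IH]; apply: scott_is_value => //=.
by rewrite IH code_basic_is_value.
Qed.

(** The arguments stand under the [n] abstractions of the Scott encoding. *)
Definition con (n i : nat) (ps : seq prog) : prog :=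
  fun d => scott n i [seq p (n + d) | p : prog <- ps].

Lemma computes_con env n i js : i < n -> all (fun j => j < size env) js ->
  computes env (con n i [seq var j | j <- js])
    (scott n i [seq nth (tvar 0) env j | j <- js]).
Proof.
case: n => // n lti ltjs _.
exists (scott n.+1 i [seq nth (tvar 0) env j | j <- js]) => //.
suff -> : close 0 env (con n.+1 i [seq var j | j <- js] (size env)) =
    scott n.+1 i [seq nth (tvar 0) env j | j <- js] by exact: eval_lam.
have close_iter m k t :
    close k env (iter m tlam t) = iter m tlam (close (m + k) env t).
  by elim: m k => //= m IH k; rewrite IH addSnnS.
rewrite /con /scott close_iter addn0 close_foldl_tapp.
have -> : close n.+1 env (tvar (n.+1 - i.+1)) = tvar (n.+1 - i.+1).
  by rewrite /= ifT //; lia.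
congr (iter _ tlam (foldl tapp _ _)); rewrite -!map_comp.
apply/eq_in_map => j /(allP ltjs) ltj /=.
rewrite ifF; last lia.
rewrite nth_rev; last lia.
have -> : size env - (n.+1 + size env - j.+1 - n.+1).+1 = j by lia.
exact: set_nth_default.
Qed.

Lemma returns_lam2 env f p q v w R :
  computes env p v -> computes env q w ->
  returns (env ++ [:: v; w]) (f (var (size env)) (var (size env).+1)) R ->
  returns env (lam (fun x => lam (f x)) @ p @ q) R.
Proof.
move=> cp cq rf.
have cfp : closure env (lam (fun x => lam (f x)) @ p) (rcons env v)
    (f (var (size env))).
  exact: returns_app (closure_lam _) cp (closure_lam _).
by apply: returns_app cfp cq _; rewrite size_rcons -!cats1 -catA.
Qed.

Lemma returns_lam1 env f p v R :
  computes env p v -> returns (env ++ [:: v]) (f (var (size env))) R ->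
  returns env (lam f @ p) R.
Proof. by rewrite cats1; apply: returns_app (closure_lam _). Qed.

Lemma halts_lam env f : halts env (lam f).
Proof. exact: halts_returns (closure_lam _). Qed.

(** The arguments of a constructor are bound by abstractions, so that they are
    evaluated before the encoding, itself an abstraction, is formed. *)
Definition con0 n i : prog := con n i [::].
Definition con1 n i p : prog := lam (fun x => con n i [:: x]) @ p.
Definition con2 n i p q : prog :=
  lam (fun x => lam (fun y => con n i [:: x; y])) @ p @ q.

Lemma computes_con0 env n i : i < n -> computes env (con0 n i) (scott n i [::]).
Proof. by move=> lti; apply: (@computes_con env n i [::]). Qed.

Lemma computes_con1 env n i p v :
  i < n -> computes env p v -> computes env (con1 n i p) (scott n i [:: v]).
Proof.
move=> lti cp; apply: returns_lam1 cp _.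
have := @computes_con (env ++ [:: v]) n i [:: size env] lti.
by rewrite /= nth_cat ltnn subnn size_cat addn1 leqnn; apply.
Qed.

Lemma computes_con2 env n i p q v w :
  i < n -> computes env p v -> computes env q w ->
  computes env (con2 n i p q) (scott n i [:: v; w]).
Proof.
move=> lti cp cq.
apply: (returns_lam2 (f := fun x y => con n i [:: x; y])) cp cq _.
have := @computes_con (env ++ [:: v; w]) n i [:: size env; (size env).+1] lti.
rewrite /= !nth_cat ltnn subnn subSnn size_cat addn2 ltnS leqnSn ltnSn.
by rewrite ltnNge leqnSn; apply.
Qed.

Definition match_bool t p q := apps t [:: p; q].
Definition match_nat t p f := apps t [:: p; lam f].
Definition match_list t p f := apps t [:: p; lam (fun x => lam (f x))].
Definition match_basic t f g := apps t [:: lam f; lam g].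
Definition match_formula t fvar p fneg fand for_ :=
  apps t [:: lam fvar; p; lam fneg;
             lam (fun x => lam (fand x)); lam (fun x => lam (for_ x))].
Definition match_pair t f := apps t [:: lam (fun x => lam (f x))].

(** The branch of a constant constructor is evaluated whatever the value
    analysed is, whence the condition that it halts. *)
Lemma returns_match_nat env t n p f R :
  computes env t (code_nat n) -> halts env p ->
  match n with
  | 0 => returns env p R
  | m.+1 => returns (env ++ [:: code_nat m]) (f (var (size env))) R
  end -> returns env (match_nat t p f) R.
Proof.
move=> ct hp r; pose bs := [:: p; lam f].
have hbs j : j < 2 -> halts env (nth (const (tvar 0)) bs j).
  by case: j => [|[|j]] // _; apply: halts_lam.
case: n ct r => [|n] ct r.
  exact: (@returns_apps env 0 t bs [::] R isT isT ct hbs r).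
have vn := code_nat_is_value n.
apply: (@returns_apps env 1 t bs [:: code_nat n] R isT _ ct hbs) => //=.
  by rewrite vn.
exact: returns_lam1 (computes_const vn) r.
Qed.

Lemma returns_match_list env t l p f R :
  computes env t (code_list l) -> halts env p ->
  match l with
  | [::] => returns env p R
  | x :: r => returns (env ++ [:: code_basic x; code_list r])
                (f (var (size env)) (var (size env).+1)) R
  end -> returns env (match_list t p f) R.
Proof.
move=> ct hp r; pose bs := [:: p; lam (fun x => lam (f x))].
have hbs j : j < 2 -> halts env (nth (const (tvar 0)) bs j).
  by case: j => [|[|j]] // _; apply: halts_lam.
case: l ct r => [|x l] ct r.
  exact: (@returns_apps env 0 t bs [::] R isT isT ct hbs r).
have [vx vl] := (code_basic_is_value x, code_list_is_value l).
apply: (@returns_apps env 1 t bs [:: code_basic x; code_list l]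
          R isT _ ct hbs) => //=.
  by rewrite vx vl.
exact: returns_lam2 (computes_const vx) (computes_const vl) r.
Qed.

Lemma returns_match_basic env t x f g R :
  computes env t (code_basic x) ->
  match x with
  | Plain a => returns (env ++ [:: code_formula a]) (f (var (size env))) R
  | Star a => returns (env ++ [:: code_formula a]) (g (var (size env))) R
  end -> returns env (match_basic t f g) R.
Proof.
move=> ct r; pose bs := [:: lam f; lam g].
have hbs j : j < 2 -> halts env (nth (const (tvar 0)) bs j).
  by case: j => [|[|j]] // _; apply: halts_lam.
case: x ct r => a ct r; have va := code_formula_is_value a.
  apply: (@returns_apps env 0 t bs [:: code_formula a] R isT _ ct hbs) => //=.
    by rewrite va.
  exact: returns_lam1 (computes_const va) r.
apply: (@returns_apps env 1 t bs [:: code_formula a] R isT _ ct hbs) => //=.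
  by rewrite va.
exact: returns_lam1 (computes_const va) r.
Qed.

Lemma returns_match_formula env t a fvar p fneg fand for_ R :
  computes env t (code_formula a) -> halts env p ->
  match a with
  | Var n => returns (env ++ [:: code_nat n]) (fvar (var (size env))) R
  | Bot => returns env p R
  | Neg b => returns (env ++ [:: code_formula b]) (fneg (var (size env))) R
  | And b c => returns (env ++ [:: code_formula b; code_formula c])
                 (fand (var (size env)) (var (size env).+1)) R
  | Or b c => returns (env ++ [:: code_formula b; code_formula c])
                 (for_ (var (size env)) (var (size env).+1)) R
  end -> returns env (match_formula t fvar p fneg fand for_) R.
Proof.
move=> ct hp r.
pose bs := [:: lam fvar; p; lam fneg;
  lam (fun x => lam (fand x)); lam (fun x => lam (for_ x))].
have hbs j : j < 5 -> halts env (nth (const (tvar 0)) bs j).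
  by case: j => [|[|[|[|[|j]]]]] // _; apply: halts_lam.
case: a ct r => [n||a|a b|a b] ct r.
- have vn := code_nat_is_value n.
  apply: (@returns_apps env 0 t bs [:: code_nat n] R isT _ ct hbs) => //=.
    by rewrite vn.
  exact: returns_lam1 (computes_const vn) r.
- exact: (@returns_apps env 1 t bs [::] R isT isT ct hbs r).
- have va := code_formula_is_value a.
  apply: (@returns_apps env 2 t bs [:: code_formula a] R isT _ ct hbs) => //=.
    by rewrite va.
  exact: returns_lam1 (computes_const va) r.
- have [va vb] := (code_formula_is_value a, code_formula_is_value b).
  apply: (@returns_apps env 3 t bs [:: code_formula a; code_formula b]
            R isT _ ct hbs) => //=.
    by rewrite va vb.
  exact: returns_lam2 (computes_const va) (computes_const vb) r.
- have [va vb] := (code_formula_is_value a, code_formula_is_value b).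
  apply: (@returns_apps env 4 t bs [:: code_formula a; code_formula b]
            R isT _ ct hbs) => //=.
    by rewrite va vb.
  exact: returns_lam2 (computes_const va) (computes_const vb) r.
Qed.

Lemma returns_match_pair env t v w f R :
  is_value v -> is_value w -> computes env t (scott 1 0 [:: v; w]) ->
  returns (env ++ [:: v; w]) (f (var (size env)) (var (size env).+1)) R ->
  returns env (match_pair t f) R.
Proof.
move=> vv vw ct r.
apply: (@returns_apps env 0 t [:: lam (fun x => lam (f x))] [:: v; w]
          R isT _ ct _) => //=; first by rewrite vv vw.
  by case=> // _; apply: halts_lam.
exact: returns_lam2 (computes_const vv) (computes_const vw) r.
Qed.

Definition p_true : prog := con0 2 0.
Definition p_false : prog := con0 2 1.
Definition p_or p q := match_bool p p_true q.
Definition p_and p q := match_bool p q p_false.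

Lemma halts_true env : halts env p_true.
Proof. exact: halts_returns (computes_con0 _). Qed.

Lemma halts_false env : halts env p_false.
Proof. exact: halts_returns (computes_con0 _). Qed.

Lemma decides_true env (P : Prop) : P -> decides env p_true P.
Proof. by move=> p; apply: returnsW (computes_con0 _) => // w ->; exists true. Qed.

Lemma decides_false env (P : Prop) : ~ P -> decides env p_false P.
Proof. by move=> np; apply: returnsW (computes_con0 _) => // w ->; exists false. Qed.

Lemma returns_match_bool env t P p q R :
  decides env t P -> halts env p -> halts env q ->
  (P -> returns env p R) -> (~ P -> returns env q R) ->
  returns env (match_bool t p q) R.
Proof.
move=> dt hp hq rp rq venv; case: (dt venv) => v et [c Ev Pc]; subst v.
have hbs j : j < 2 -> halts env (nth (const (tvar 0)) [:: p; q] j).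
  by case: j => [|[|j]].
have ct : computes env t (code_bool c) by move=> _; exists (code_bool c).
move: venv; case: c {et} ct Pc => ct [Pc cP] venv.
  exact: (@returns_apps env 0 t [:: p; q] [::] R isT isT ct hbs (rp (cP isT))) venv.
have nP : ~ P by move=> /Pc.
exact: (@returns_apps env 1 t [:: p; q] [::] R isT isT ct hbs (rq nP)) venv.
Qed.

Lemma decides_or env p q P Q :
  decides env p P -> decides env q Q -> decides env (p_or p q) (P \/ Q).
Proof.
move=> dp dq; apply: (returns_match_bool dp).
- exact: halts_true.
- exact: halts_returns dq.
- by move=> hP; apply: decides_true; left.
- by move=> nP; apply: decides_iff dq; split=> [|[]//]; right.
Qed.

Lemma decides_and env p q P Q :
  decides env p P -> decides env q Q -> decides env (p_and p q) (P /\ Q).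
Proof.
move=> dp dq; apply: (returns_match_bool dp).
- exact: halts_returns dq.
- exact: halts_false.
- by move=> hP; apply: decides_iff dq; split=> [|[]].
- by move=> nP; apply: decides_false; case.
Qed.

Definition p_nil := con0 2 0.
Definition p_cons := con2 2 1.
Definition p_neg := con1 5 2.
Definition p_plain := con1 2 0.
Definition p_star := con1 2 1.

Lemma computes_nil env : computes env p_nil (code_list [::]).
Proof. exact: computes_con0. Qed.

Lemma computes_cons env p q x l :
  computes env p (code_basic x) -> computes env q (code_list l) ->
  computes env (p_cons p q) (code_list (x :: l)).
Proof. exact: computes_con2. Qed.

Lemma computes_plain env p f :
  computes env p (code_formula f) -> computes env (p_plain p) (code_basic (Plain f)).
Proof. exact: computes_con1. Qed.

Lemma computes_star env p f :
  computes env p (code_formula f) -> computes env (p_star p) (code_basic (Star f)).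
Proof. exact: computes_con1. Qed.

Lemma computes_neg env p f :
  computes env p (code_formula f) -> computes env (p_neg p) (code_formula (Neg f)).
Proof. exact: computes_con1. Qed.

Ltac computes :=
  lazymatch goal with
  | |- computes _ p_nil _ => exact: computes_nil
  | |- computes _ (p_cons _ _) _ => apply: computes_cons; computes
  | |- computes _ (p_plain _) _ => apply: computes_plain; computes
  | |- computes _ (p_star _) _ => apply: computes_star; computes
  | |- computes _ (p_neg _) _ => apply: computes_neg; computes
  | |- computes _ (const _) _ => exact: computes_const
  | |- _ => by apply: computes_var
  end.

(** * Recursion *)

(** A recursive function is a term [D] that receives itself as first argument;
    the function proper is [D] applied to itself.  Inside its body, [D] is the
    outermost variable, so recursive calls have the shape [var 0 @ var 0] where
    calls from elsewhere have [const D @ const D]; a head [h] returning [D]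
    covers both. *)
Definition fix_tm (body : prog -> prog -> prog) : tm :=
  lam (fun s => lam (body (s @ s))) 0.

Lemma returns_fix env h body p v R :
  closed_tm (fix_tm body) -> computes env h (fix_tm body) -> computes env p v ->
  returns [:: fix_tm body; v] (body (var 0 @ var 0) (var 1)) R ->
  returns env (h @ h @ p) R.
Proof.
move=> cD ch cp rb.
apply: (@returns_app env [:: fix_tm body] _ _ (body (var 0 @ var 0)) _ _ _ cp rb).
apply: (@returns_app env [::] _ _ (fun s => lam (body (s @ s))) _ _ _ ch).
  by apply: returnsW ch => w ->; rewrite close_closed.
exact: (@closure_lam [:: fix_tm body] (body (var 0 @ var 0))).
Qed.

Lemma returns_fix2 env h f p q v w R :
  let D := fix_tm (fun s x => lam (f s x)) in
  closed_tm D -> computes env h D -> computes env p v -> computes env q w ->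
  returns [:: D; v; w] (f (var 0 @ var 0) (var 1) (var 2)) R ->
  returns env (h @ h @ p @ q) R.
Proof.
move=> D cD ch cp cq.
exact: returns_app (returns_fix cD ch cp (closure_lam _)) cq.
Qed.

Lemma returns_fix3 env h f p q r v w u R :
  let D := fix_tm (fun s x => lam (fun y => lam (f s x y))) in
  closed_tm D -> computes env h D ->
  computes env p v -> computes env q w -> computes env r u ->
  returns [:: D; v; w; u] (f (var 0 @ var 0) (var 1) (var 2) (var 3)) R ->
  returns env (h @ h @ p @ q @ r) R.
Proof.
move=> D cD ch cp cq cr.
exact: returns_app (returns_fix2 cD ch cp cq (closure_lam _)) cr.
Qed.

Definition eqn_body (eqn m n : prog) : prog :=
  match_nat m (match_nat n p_true (fun=> p_false))
    (fun m' => match_nat n p_false (fun n' => eqn @ m' @ n')).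
Definition eqn_tm : tm := fix_tm (fun eqn m => lam (eqn_body eqn m)).

(** The search passes over the antecedent with a list of the structures already
    seen; reversed concatenation restores the rest of the antecedent up to
    order, which is all that a multiset retains. *)
Definition revcat_body (revcat p r : prog) : prog :=
  match_list p r (fun x p' => revcat @ p' @ p_cons x r).
Definition revcat_tm : tm := fix_tm (fun revcat p => lam (revcat_body revcat p)).

Lemma decides_eqn m n env h p q :
  computes env h eqn_tm ->
  computes env p (code_nat m) -> computes env q (code_nat n) ->
  decides env (h @ h @ p @ q) (m = n).
Proof.
elim: m n env h p q => [|m IH] n env h p q ch cp cq;
  apply: (@returns_fix2 _ _ eqn_body _ _ _ _ _ isT ch cp cq);
  set env' := [:: _; _; _];
  have d0 : decides env' (match_nat (var 2) p_true (fun=> p_false)) (0 = n).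
- apply: (@returns_match_nat _ _ n); [computes|exact: halts_true|].
  by case: n cq @env' => [|n] _ env'; [apply: decides_true|apply: decides_false].
- by apply: (@returns_match_nat _ _ 0); [computes|apply: halts_returns d0|].
- apply: (@returns_match_nat _ _ n); [computes|exact: halts_true|].
  by case: n cq @env' => [|n] _ env'; [apply: decides_true|apply: decides_false].
apply: (@returns_match_nat _ _ m.+1); [computes|exact: halts_returns d0|].
apply: (@returns_match_nat _ _ n); [computes|exact: halts_false|].
case: n cq @env' {d0} => [|n] _ env'; first exact: decides_false.
apply: (@decides_iff _ _ (m = n)); first by split=> [->|[]].
by apply: IH; computes.
Qed.

Lemma computes_revcat l r env h p q :
  computes env h revcat_tm -> computes env p (code_list l) ->
  computes env q (code_list r) ->
  computes env (h @ h @ p @ q) (code_list (catrev l r)).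
Proof.
elim: l r env h p q => [|x l IH] r env h p q ch cp cq;
  apply: (@returns_fix2 _ _ revcat_body _ _ _ _ _ isT ch cp cq);
  set env' := [:: _; _; _];
  have c2 : computes env' (var 2) (code_list r) by computes.
  by apply: (@returns_match_list _ _ [::]); [computes|apply: halts_returns c2|].
apply: (@returns_match_list _ _ (x :: l)); [computes|exact: halts_returns c2|].
apply: IH; [computes|computes|].
by apply: computes_cons; computes.
Qed.

(** * Backward proof search *)

(** The constants make every rule decrease the weight.  A star weighs one and a
    negation two, because the rules for negation trade a negation for a star;
    splitting a starred negated conjunction duplicates the star and the negation,
    so a binary connective weighs more than both together. *)
Fixpoint formula_weight (f : formula) : nat :=
  match f with
  | Var _ | Bot => 0
  | Neg a => formula_weight a + 2
  | And a b | Or a b => formula_weight a + formula_weight b + 4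
  end.

Definition basic_weight (x : basic) : nat :=
  match x with Plain f => formula_weight f | Star f => (formula_weight f).+1 end.

Definition list_weight (l : seq basic) : nat := sumn (map basic_weight l).

Lemma list_weight_catrev l r :
  list_weight (catrev l r) = list_weight l + list_weight r.
Proof. by rewrite catrevE /list_weight map_cat sumn_cat map_rev sumn_rev. Qed.

(** Whether the sequent follows by a right rule from derivable premises. *)
Definition right_step (G : structure) (b : basic) : Prop :=
  match b with
  | Plain (And f g) => G3SDM |- G => Plain f /\ G3SDM |- G => Plain g
  | Plain (Or f g) => G3SDM |- G => Plain f \/ G3SDM |- G => Plain g
  | Plain (Neg f) => G3SDM |- G => Star f
  | Star Bot => True
  | Star (Or f g) => G3SDM |- G => Star f /\ G3SDM |- G => Star g
  | Star (Neg (And f g)) => G3SDM |- G => Star (Neg f) /\ G3SDM |- G => Star (Neg g)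
  | Star (Neg (Neg f)) => G3SDM |- G => Star f
  | _ => False
  end.

(** The same for rules with principal structure [x] on the left, where [G] is the
    rest of the antecedent. *)
Definition left_step (x : basic) (G : structure) (b : basic) : Prop :=
  match x with
  | Plain (Var p) => b = Plain (Var p)
  | Plain Bot => True
  | Plain (And f g) => G3SDM |- Plain f +` (Plain g +` G) => b
  | Plain (Or f g) => G3SDM |- Plain f +` G => b /\ G3SDM |- Plain g +` G => b
  | Plain (Neg f) => G3SDM |- Star f +` G => b
  | Star y =>
    (if b is Star f then G3SDM |- [mset Plain f] => Plain y else False) \/
    match y with
    | Or f g => G3SDM |- Star f +` (Star g +` G) => b
    | Neg Bot => True
    | Neg (And f g) => G3SDM |- Star (Neg f) +` (Star (Neg g) +` G) => b
    | Neg (Neg f) => G3SDM |- Star f +` G => b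
    | _ => False
    end
  end.

(** Inversion of the last rule, sorted by the side of its principal structure;
    the structural rule counts as a rule for the starred structure on the
    left. *)
Lemma derivable_step G b :
  G3SDM |- G => b <->
  right_step G b \/ exists2 x, x \in G & left_step x (G `\ x) b.
Proof.
split=> [|[|[x /msetB1K <-]]]; last 2 first.
- case: b => [[p||f|f g|f g]|[p||[p||f|f g|f g]|f g|f g]] //=.
  + exact: NegR.
  + by case; apply: AndR.
  + by case; [apply: OrR1|apply: OrR2].
  + by move=> _; apply: StarBotR.
  + exact: StarNegNegR.
  + by case; apply: StarNegAndR.
  + by case; apply: StarOrR.
- move: (G `\ x) => {}G; case: x => [[p||f|f g|f g]|y] /=; rewrite ?msetD1K.
  + by move=> ->; apply: Ax.
  + by move=> _; apply: BotL.
  + exact: NegL.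
  + exact: AndL.
  + by case; apply: OrL.
  case; first by case: b => // f; apply: StarRule.
  case: y => [p||[p||f|f g|f g]|f g|f g] //.
  + by move=> _; apply: StarNegBotL.
  + exact: StarNegNegL.
  + exact: StarNegAndL.
  + exact: StarOrL.
move: {-1}(G, b) (erefl (G, b)) => S ES Sd.
case: Sd ES => [p G'|G' b'|G'|G' b'|f g G' b' d|f g G' d e|f g G' b' d e
  |f g G' d|f g G' d|f g G' b' d|f g G' d e|f g G' b' d|f g G' d e|f G' b' d
  |f G' d|f G' b' d|f G' d|f g G' d] [-> ->]; try by left; rewrite /=; auto.
all: by right; eexists; [exact: mset1D1|rewrite msetD1K /=; auto].
Qed.

Lemma derivable_step_seq l b :
  G3SDM |- seq_mset l => b <->
  right_step (seq_mset l) b \/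
  exists2 x, x \in l & left_step x (seq_mset l `\ x) b.
Proof.
have memE := perm_mem (perm_eq_seq_mset l).
by apply: iff_trans (derivable_step _ _) _; split=> -[?|[x xl ?]];
  [left|right; exists x; rewrite -?memE|left|right; exists x; rewrite ?memE].
Qed.

Lemma seq_mset_cons (x : basic) l : seq_mset (x :: l) = x +` seq_mset l.
Proof. by apply/msetP => y; rewrite mset1DE !mset_seqE /= eq_sym. Qed.

Lemma seq_mset1 (x : basic) : seq_mset [:: x] = [mset x].
Proof.
by apply/msetP => y; rewrite mset_seqE msetnE /= addn0 eq_sym; case: eqP.
Qed.

(** * The decision algorithm *)

Definition right_prog (prove : prog -> prog -> prog) (l b : prog) : prog :=
  match_basic b
    (fun f => match_formula f
      (fun=> p_false)
      p_false
      (fun g => prove l (p_star g))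
      (fun g h => p_and (prove l (p_plain g)) (prove l (p_plain h)))
      (fun g h => p_or (prove l (p_plain g)) (prove l (p_plain h))))
    (fun f => match_formula f
      (fun=> p_false)
      p_true
      (fun f' => match_formula f'
        (fun=> p_false)
        p_false
        (fun g => prove l (p_star g))
        (fun g h => p_and (prove l (p_star (p_neg g)))
                          (prove l (p_star (p_neg h))))
        (fun _ _ => p_false))
      (fun _ _ => p_false)
      (fun g h => p_and (prove l (p_star g)) (prove l (p_star h)))).

Definition left_prog (prove : prog -> prog -> prog) (x l b : prog) : prog :=
  match_basic x
    (fun f => match_formula f
      (fun m => match_basic b
        (fun f' => match_formula f'
          (fun n => const eqn_tm @ const eqn_tm @ n @ m)
          p_false
          (fun=> p_false)
          (fun _ _ => p_false)
          (fun _ _ => p_false))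
        (fun=> p_false))
      p_true
      (fun g => prove (p_cons (p_star g) l) b)
      (fun g h => prove (p_cons (p_plain g) (p_cons (p_plain h) l)) b)
      (fun g h => p_and (prove (p_cons (p_plain g) l) b)
                        (prove (p_cons (p_plain h) l) b)))
    (fun f => p_or
      (match_basic b
        (fun=> p_false)
        (fun g => prove (p_cons (p_plain g) p_nil) (p_plain f)))
      (match_formula f
        (fun=> p_false)
        p_false
        (fun f' => match_formula f'
          (fun=> p_false)
          p_true
          (fun g => prove (p_cons (p_star g) l) b)
          (fun g h =>
             prove (p_cons (p_star (p_neg g)) (p_cons (p_star (p_neg h)) l)) b)
          (fun _ _ => p_false))
        (fun _ _ => p_false)
        (fun g h => prove (p_cons (p_star g) (p_cons (p_star h) l)) b))).

(** One recursive function serves both as the search and as its loop over the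
    candidates for the principal structure: the antecedent consists of [pre] and
    [l] together, but left rules are tried only on the structures in [l], and a
    new sequent starts with [pre] empty.  When [l] is exhausted, the right rules
    are tried. *)
Definition prove_body (self pre l b : prog) : prog :=
  let prove p q := self @ p_nil @ p @ q in
  match_list l (right_prog prove pre b)
    (fun x r => p_or (self @ p_cons x pre @ r @ b)
      (lam (fun rest => left_prog prove x rest b)
        @ (const revcat_tm @ const revcat_tm @ pre @ r))).

Definition prove_tm : tm :=
  fix_tm (fun self pre => lam (fun l => lam (prove_body self pre l))).

Arguments code_nat : simpl never.
Arguments code_formula : simpl never.
Arguments code_basic : simpl never.
Arguments code_list : simpl never.

(** The induction hypothesis for the recursive calls.  The calls occur under the
    binders of case analyses, hence the quantification over the environment, of
    which only the bottom entry, the recursive function, is fixed. *)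
Definition decides_below n D (prove : prog -> prog -> prog) :=
  forall env p q l b, list_weight l + basic_weight b < n ->
  computes (D :: env) p (code_list l) -> computes (D :: env) q (code_basic b) ->
  decides (D :: env) (prove p q) (G3SDM |- seq_mset l => b).

(** The environments here and in [decides_left] are those in which [prove_body]
    runs these programs.  The weight of the sequent may equal [n], since the
    premises, on which [prove] is called, are lighter than the sequent. *)
Lemma decides_right n D prove pre e b :
  decides_below n D prove -> list_weight pre + basic_weight b <= n ->
  decides [:: D; code_list pre; e; code_basic b]
    (right_prog prove (var 1) (var 3)) (right_step (seq_mset pre) b).
Proof.
move=> IH le_n.
have IH' env p c : basic_weight c < basic_weight b ->
    computes (D :: env) p (code_list pre) ->
    forall q, computes (D :: env) q (code_basic c) ->
    decides (D :: env) (prove p q) (G3SDM |- seq_mset pre => c).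
  by move=> ltc cp q cq; apply: IH => //; lia.
apply: (@returns_match_basic _ _ b); first computes.
case: b le_n IH' => f _ IH'; apply: (@returns_match_formula _ _ f); try computes.
- exact: halts_false.
- case: f IH' => [m||g|g h|g h] IH' /=; try exact: decides_false.
  + by apply: IH' => /=; [lia|computes|computes].
  + apply: decides_and.
      by apply: IH' => /=; [lia|computes|computes].
    by apply: IH' => /=; [lia|computes|computes].
  + apply: decides_or.
      by apply: IH' => /=; [lia|computes|computes].
    by apply: IH' => /=; [lia|computes|computes].
- exact: halts_true.
case: f IH' => [m||g|g h|g h] IH' /=; try exact: decides_false.
- exact: decides_true.
- apply: (@returns_match_formula _ _ g); [computes|exact: halts_false|].
  case: g IH' => [m||g|g h|g h] IH' /=; try exact: decides_false.
  + by apply: IH' => /=; [lia|computes|computes].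
  + apply: decides_and.
      by apply: IH' => /=; [lia|computes|computes].
    by apply: IH' => /=; [lia|computes|computes].
- apply: decides_and.
    by apply: IH' => /=; [lia|computes|computes].
  by apply: IH' => /=; [lia|computes|computes].
Qed.

Lemma decides_left n D prove x l b e1 e2 e5 :
  decides_below n D prove ->
  basic_weight x + list_weight l + basic_weight b <= n ->
  decides [:: D; e1; e2; code_basic b; code_basic x; e5; code_list l]
    (left_prog prove (var 4) (var 6) (var 3)) (left_step x (seq_mset l) b).
Proof.
move=> IH le_n.
have IH' env p q l' b' : list_weight l' + basic_weight b' <
    basic_weight x + list_weight l + basic_weight b ->
    computes (D :: env) p (code_list l') ->
    computes (D :: env) q (code_basic b') ->
    decides (D :: env) (prove p q) (G3SDM |- seq_mset l' => b').
  by move=> lt_x; apply: IH; apply: leq_trans le_n.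
clear IH le_n; rewrite /list_weight in IH'; case: x IH' => f IH.
  apply: (@returns_match_basic _ _ (Plain f)); first computes.
  apply: (@returns_match_formula _ _ f); [computes|exact: halts_true|].
  case: f IH => [m||g|g h|g h] IH /=; rewrite -?seq_mset_cons.
  - apply: (@returns_match_basic _ _ b); first computes.
    case: b {IH} => f; last exact: decides_false.
    apply: (@returns_match_formula _ _ f); [computes|exact: halts_false|].
    case: f => [k||g|g h|g h] /=; try exact: decides_false.
    apply: (@decides_iff _ _ (k = m)); first by split=> [->|[]].
    by apply: decides_eqn; computes.
  - exact: decides_true.
  - by apply: IH => /=; [lia|computes|computes].
  - by apply: IH => /=; [lia|computes|computes].
  - by apply: decides_and; (apply: IH => /=; [lia|computes|computes]).
apply: (@returns_match_basic _ _ (Star f)); first computes.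
apply: decides_or.
  apply: (@returns_match_basic _ _ b); first computes.
  case: b IH => g IH; first exact: decides_false.
  by rewrite -seq_mset1; apply: IH => /=; [lia|computes|computes].
apply: (@returns_match_formula _ _ f); [computes|exact: halts_false|].
case: f IH => [m||f|g h|g h] IH /=; rewrite -?seq_mset_cons;
  try exact: decides_false.
  apply: (@returns_match_formula _ _ f); [computes|exact: halts_true|].
  case: f IH => [m||g|g h|g h] IH /=; rewrite -?seq_mset_cons;
    try exact: decides_false.
  - exact: decides_true.
  - by apply: IH => /=; [lia|computes|computes].
  - by apply: IH => /=; [lia|computes|computes].
by apply: IH => /=; [lia|computes|computes].
Qed.

(** Outer induction on a bound for the weight, for the recursive calls on
    premises, and inner induction on [l], for the loop. *)
Lemma decides_prove n pre l b env h p q r :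
  list_weight pre + list_weight l + basic_weight b < n ->
  computes env h prove_tm -> computes env p (code_list pre) ->
  computes env q (code_list l) -> computes env r (code_basic b) ->
  let G := seq_mset (catrev pre l) in
  decides env (h @ h @ p @ q @ r)
    (right_step G b \/ exists2 x, x \in l & left_step x (G `\ x) b).
Proof.
elim: n pre l b env h p q r => // n IHn pre l b env h p q r.
rewrite ltnS => le_n ch cp cq cr.
have below : decides_below n prove_tm
    (fun p q => var 0 @ var 0 @ p_nil @ p @ q).
  move=> env' p' q' l' b' lt_n cp' cq'.
  apply: decides_iff (iff_sym (derivable_step_seq l' b')) _.
  by apply: (IHn [::] l' b' _ (var 0) p_nil p' q' lt_n _ _ cp' cq'); computes.
elim: l pre env h p q r le_n ch cp cq cr =>
    [|x l IHl] pre env h p q r le_n ch cp cq cr G;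
  apply: (@returns_fix3 _ _ prove_body _ _ _ _ _ _ _ isT ch cp cq cr).
- have Gpre : seq_mset pre = G.
    by apply/eq_seq_msetP; rewrite /G catrevE cats0 perm_sym perm_rev.
  have right : decides [:: prove_tm; code_list pre; code_list [::]; code_basic b]
      (right_prog (fun p q => var 0 @ var 0 @ p_nil @ p @ q) (var 1) (var 3))
      (right_step G b).
    rewrite -Gpre; apply: (@decides_right n _ _ pre _ b below).
    by move: le_n; rewrite /list_weight /=; lia.
  apply: (@returns_match_list _ _ [::]); [computes|exact: halts_returns right|].
  by apply: decides_iff right; split=> [|[//|[]//]]; left.
apply: (@returns_match_list _ _ (x :: l)); first computes.
  (* The right rules are evaluated on [pre] alone here; their result is dropped,
     but they must halt. *)
  apply: halts_returns (@decides_right n _ _ pre (code_list (x :: l)) b below _).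
  by move: le_n; rewrite /list_weight /=; lia.
rewrite -/prove_tm.
have Gx : G = x +` seq_mset (catrev pre l).
  rewrite -seq_mset_cons; apply/eq_seq_msetP.
  by rewrite !catrevE -[x :: l]cat1s perm_catCA.
apply: (@decides_iff _ _ ((right_step G b \/
    exists2 y, y \in l & left_step y (G `\ y) b) \/
    left_step x (seq_mset (catrev pre l)) b)).
  rewrite -(msetD1K x (seq_mset _)) -Gx; split=> [[[?|[y yl ?]]|?]|[?|[y]]].
  - by left.
  - by right; exists y; rewrite // inE yl orbT.
  - by right; exists x; rewrite // mem_head.
  - by left; left.
  - by rewrite inE => /predU1P[->|yl] ?; [right|left; right; exists y].
apply: decides_or.
  apply: (IHl (x :: pre)); try by computes.
  by move: le_n; rewrite /list_weight /=; lia.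
apply: returns_lam1; first by apply: computes_revcat; computes.
apply: (@decides_left n) => //.
by move: le_n; rewrite list_weight_catrev /list_weight /=; lia.
Qed.

Lemma decides_derivable env l b p q :
  computes env p (code_list l) -> computes env q (code_basic b) ->
  decides env (const prove_tm @ const prove_tm @ p_nil @ p @ q)
    (G3SDM |- seq_mset l => b).
Proof.
move=> cp cq; apply: decides_iff (iff_sym (derivable_step_seq l b)) _.
apply: (decides_prove (pre := [::]) (ltnSn _) _ _ cp cq); last exact: computes_nil.
exact: (computes_const (v := prove_tm)).
Qed.

Theorem theorem3p18 : algorithmically_decidable sequent_code G3SDM_derivable.
Proof.
pose u := lam (fun s => match_pair s
  (fun l b => const prove_tm @ const prove_tm @ p_nil @ l @ b)).
exists (u 0) => // -[G b] _ [l /= <- ->].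
set t := scott _ _ _.
have vt : is_value t.
  by apply: scott_is_value; rewrite //= code_list_is_value code_basic_is_value.
have [] : decides [::] (u @ const t) (G3SDM |- seq_mset l => b) => //.
  apply: returns_lam1 (computes_const vt) _.
  have ct := @computes_var [:: t] 0 isT.
  have [vl vb] := (code_list_is_value l, code_basic_is_value b).
  apply: (@returns_match_pair [:: t] _ _ _ _ _ vl vb ct);
    apply: decides_derivable; computes.
move=> w ev [c Ew Pc]; subst w.
have {}ev : eval (tapp (u 0) t) (code_bool c).
  have cut : closed_tm (tapp (u 0) t) by case/andP: vt.
  by rewrite -(close_closed [::] cut).
split=> [/Pc|nd]; first by case: c ev {Pc}.
by case: c ev Pc => // _ [_ /(_ isT)].
Qed.
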